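(* Let $S = M_{d_1}(\mathbb{C})\oplus\dots\oplus M_{d_k}(\mathbb{C})$ be a finite dimensional semi-simple algebra. Then there is an isomorphism of $S$-bimodules $$\mathrm{Der}(S,S\otimes S)\;\cong\;\bigoplus_{i=1}^k M_{d_i}(\mathbb{C})^{\oplus (d_i^2-1)}\;\oplus\;\bigoplus_{i\neq j} M_{d_i\times d_j}(\mathbb{C})^{\oplus d_id_j},$$ where the second sum runs over ordered pairs $(i,j)$ with $1\le i\neq j\le k$, the bimodule structure on the left is the inner one, and the bimodule structure on the right is matrix multiplication: $(s_1,\dots,s_k)$ acts on the left of each copy of $M_{d_i}(\mathbb{C})$ and of $M_{d_i\times d_j}(\mathbb{C})$ by left multiplication with $s_i$, and $(t_1,\dots,t_k)$ acts on the right of each copy of $M_{d_i}(\mathbb{C})$ by right multiplication with $t_i$ and of $M_{d_i\times d_j}(\mathbb{C})$ by right multiplication with $t_j$.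
   Context: $\mathbb{C}$ denotes an algebraically closed field of characteristic $0$, and $\otimes=\otimes_{\mathbb{C}}$. The outer $S$-bimodule structure on $S\otimes S$ is $a\cdot(a'\otimes a'')\cdot b=(aa')\otimes(a''b)$; the inner one is $a\circ(a'\otimes a'')\circ b=(a'b)\otimes(aa'')$. $\mathrm{Der}(S,S\otimes S)$ is the space of double derivations of $S$, i.e. $\mathbb{C}$-linear derivations $S\to S\otimes S$ with respect to the outer bimodule structure. It is an $S$-bimodule via the inner structure: $(s\vartheta t)(u)=\vartheta(u)'t\otimes s\vartheta(u)''$, where $\vartheta(u)=\vartheta(u)'\otimes\vartheta(u)''$ is Sweedler notation (sum suppressed). *)

(* Defs.v *)
From HB Require Import structures.
From mathcomp Require Import all_boot all_algebra all_field.
From mathcomp Require Import boolp.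
Set Implicit Arguments.
Unset Strict Implicit.
Unset Printing Implicit Defensive.
Import GRing.Theory.
Local Open Scope ring_scope.

HB.mixin Record Lmodule_isBimodule (C : fieldType) (A : algType C) (M : Type)
    of GRing.Lmodule C M := {
  lact : A -> M -> M;
  ract : M -> A -> M;
  lact_linearl : forall m, linear (lact^~ m);
  lact_linearr : forall a, linear (lact a);
  ract_linearl : forall a, linear (ract^~ a);
  ract_linearr : forall m, linear (ract m);
  lact1 : forall m, lact 1 m = m;
  ract1 : forall m, ract m 1 = m;
  lactM : forall a b m, lact (a * b) m = lact a (lact b m);
  ractM : forall a b m, ract m (a * b) = ract (ract m a) b;
  lractA : forall a b m, ract (lact a m) b = lact a (ract m b)
}.

#[short(type="bimodType")]
HB.structure Definition Bimodule (C : fieldType) (A : algType C) :=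
  { M of GRing.Lmodule C M & Lmodule_isBimodule C A M }.

Definition bimod_isomorphic (C : fieldType) (A : algType C)
    (M N : bimodType A) : Prop :=
  exists f : {linear M -> N},
    [/\ bijective f,
        forall (a : A) (m : M), f (lact a m) = lact a (f m)
      & forall (m : M) (a : A), f (ract m a) = ract (f m) a].

Section PairBimodule.
Variables (C : fieldType) (A : algType C) (M N : bimodType A).
Local Notation P := (M * N)%type.

Definition pair_lact (a : A) (x : P) : P := (lact a x.1, lact a x.2).
Definition pair_ract (x : P) (a : A) : P := (ract x.1 a, ract x.2 a).

Fact pair_lact_linearl x : linear (pair_lact^~ x).
Proof. by move=> c a b; congr pair; rewrite lact_linearl. Qed.
Fact pair_lact_linearr a : linear (pair_lact a).
Proof. by move=> c x y; congr pair; rewrite lact_linearr. Qed.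
Fact pair_ract_linearl a : linear (pair_ract^~ a).
Proof. by move=> c x y; congr pair; rewrite ract_linearl. Qed.
Fact pair_ract_linearr x : linear (pair_ract x).
Proof. by move=> c a b; congr pair; rewrite ract_linearr. Qed.
Fact pair_lact1 x : pair_lact 1 x = x.
Proof. by case: x => x y; congr pair; rewrite lact1. Qed.
Fact pair_ract1 x : pair_ract x 1 = x.
Proof. by case: x => x y; congr pair; rewrite ract1. Qed.
Fact pair_lactM a b x : pair_lact (a * b) x = pair_lact a (pair_lact b x).
Proof. by congr pair; rewrite lactM. Qed.
Fact pair_ractM a b x : pair_ract x (a * b) = pair_ract (pair_ract x a) b.
Proof. by congr pair; rewrite ractM. Qed.
Fact pair_lractA a b x :
  pair_ract (pair_lact a x) b = pair_lact a (pair_ract x b).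
Proof. by congr pair; rewrite lractA. Qed.

HB.instance Definition _ := Lmodule_isBimodule.Build C A P
  pair_lact_linearl pair_lact_linearr pair_ract_linearl pair_ract_linearr
  pair_lact1 pair_ract1 pair_lactM pair_ractM pair_lractA.
End PairBimodule.

Definition dsum (R : pzRingType) (I : finType) (V : I -> lmodType R) : Type :=
  {dffun forall i, V i}.

Section DirectSum.
Variables (R : pzRingType) (I : finType) (V : I -> lmodType R).
Local Notation D := (dsum V).

HB.instance Definition _ := Choice.copy D {dffun forall i, V i}.

Definition mkds (f : forall i, V i) : D := [ffun i => f i].
Definition dsum_at (x : D) (i : I) : V i := (x : {dffun forall i, V i}) i.
Lemma mkdsE f i : dsum_at (mkds f) i = f i. Proof. exact: ffunE. Qed.
Lemma dsumP (x y : D) : (forall i, dsum_at x i = dsum_at y i) -> x = y.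
Proof. by move=> e; apply/ffunP. Qed.

Definition dsum_add (x y : D) : D := mkds (fun i => dsum_at x i + dsum_at y i).
Definition dsum_opp (x : D) : D := mkds (fun i => - dsum_at x i).
Definition dsum_scale (c : R) (x : D) : D := mkds (fun i => c *: dsum_at x i).

Fact dsum_addA : associative dsum_add.
Proof. by move=> x y z; apply: dsumP => i; rewrite !mkdsE addrA. Qed.
Fact dsum_addC : commutative dsum_add.
Proof. by move=> x y; apply: dsumP => i; rewrite !mkdsE addrC. Qed.
Fact dsum_add0 : left_id (mkds (fun=> 0)) dsum_add.
Proof. by move=> x; apply: dsumP => i; rewrite !mkdsE add0r. Qed.
Fact dsum_addN : left_inverse (mkds (fun=> 0)) dsum_opp dsum_add.
Proof. by move=> x; apply: dsumP => i; rewrite !mkdsE addNr. Qed.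
HB.instance Definition _ :=
  GRing.isZmodule.Build D dsum_addA dsum_addC dsum_add0 dsum_addN.

Fact dsum_scaleA a b x : dsum_scale a (dsum_scale b x) = dsum_scale (a * b) x.
Proof. by apply: dsumP => i; rewrite !mkdsE scalerA. Qed.
Fact dsum_scale1 : left_id 1 dsum_scale.
Proof. by move=> x; apply: dsumP => i; rewrite !mkdsE scale1r. Qed.
Fact dsum_scaleDr : right_distributive dsum_scale +%R.
Proof. by move=> a x y; apply: dsumP => i; rewrite !mkdsE scalerDr. Qed.
Fact dsum_scaleDl x : {morph dsum_scale^~ x : a b / a + b}.
Proof. by move=> a b; apply: dsumP => i; rewrite !mkdsE scalerDl. Qed.
HB.instance Definition _ := GRing.Zmodule_isLmodule.Build R D
  dsum_scaleA dsum_scale1 dsum_scaleDr dsum_scaleDl.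

Lemma dsumDE (x y : D) i : dsum_at (x + y) i = dsum_at x i + dsum_at y i.
Proof. exact: mkdsE. Qed.
Lemma dsumZE c (x : D) i : dsum_at (c *: x) i = c *: dsum_at x i.
Proof. exact: mkdsE. Qed.
Definition dsumE := (mkdsE, dsumDE, dsumZE).
End DirectSum.

Section DirectSumVector.
Variables (K : fieldType) (I : finType) (V : I -> vectType K).
Local Notation D := (@dsum K I (fun i => V i : lmodType K)).
Local Notation T := {i : I & 'I_(\dim {:V i})}.

Fact dsum_vect_iso : Vector.axiom #|{: T}| D.
Proof.
pose f (x : D) : 'rV[K]_#|{: T}| :=
  \row_j coord (vbasis {:V (tag (enum_val j))}) (tagged (enum_val j))
           (dsum_at x (tag (enum_val j)) : V _).
exists f => [c x y|].
  by apply/rowP=> j; rewrite !mxE !dsumE linearP.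
pose e i (c : 'I_(\dim {:V i})) : T := Tagged _ c.
pose g (u : 'rV[K]_#|{: T}|) : D :=
  mkds (fun i => \sum_c u 0 (enum_rank (e i c)) *: (vbasis {:V i})`_c).
exists g => [x|u].
  apply: dsumP => i; rewrite mkdsE [RHS](coord_vbasis (memvf (_ : V i))).
  by apply: eq_bigr => c _; rewrite !mxE enum_rankK.
apply/rowP=> j; rewrite !mxE mkdsE.
rewrite coord_sum_free ?(basis_free (vbasisP _)) //.
by rewrite /e taggedK enum_valK.
Qed.
End DirectSumVector.

Definition bisum (C : fieldType) (A : algType C) (I : finType)
  (M : I -> bimodType A) : Type := @dsum C I (fun i => M i : lmodType C).

Section DirectSumBimodule.
Variables (C : fieldType) (A : algType C) (I : finType) (M : I -> bimodType A).
Local Notation D := (bisum M).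
HB.instance Definition _ :=
  GRing.Lmodule.copy D (@dsum C I (fun i => M i : lmodType C)).

Definition bisum_lact (a : A) (x : D) : D :=
  mkds (fun i => (lact a (dsum_at x i : M i) : M i) : (M i : lmodType C)).
Definition bisum_ract (x : D) (a : A) : D :=
  mkds (fun i => (ract (dsum_at x i : M i) a : M i) : (M i : lmodType C)).

Fact bisum_lact_linearl x : linear (bisum_lact^~ x).
Proof. by move=> c a b; apply: dsumP => i; rewrite !dsumE lact_linearl. Qed.
Fact bisum_lact_linearr a : linear (bisum_lact a).
Proof. by move=> c x y; apply: dsumP => i; rewrite !dsumE lact_linearr. Qed.
Fact bisum_ract_linearl a : linear (bisum_ract^~ a).
Proof. by move=> c x y; apply: dsumP => i; rewrite !dsumE ract_linearl. Qed.
Fact bisum_ract_linearr x : linear (bisum_ract x).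
Proof. by move=> c a b; apply: dsumP => i; rewrite !dsumE ract_linearr. Qed.
Fact bisum_lact1 x : bisum_lact 1 x = x.
Proof. by apply: dsumP => i; rewrite !dsumE lact1. Qed.
Fact bisum_ract1 x : bisum_ract x 1 = x.
Proof. by apply: dsumP => i; rewrite !dsumE ract1. Qed.
Fact bisum_lactM a b x : bisum_lact (a * b) x = bisum_lact a (bisum_lact b x).
Proof. by apply: dsumP => i; rewrite !dsumE lactM. Qed.
Fact bisum_ractM a b x : bisum_ract x (a * b) = bisum_ract (bisum_ract x a) b.
Proof. by apply: dsumP => i; rewrite !dsumE ractM. Qed.
Fact bisum_lractA a b x :
  bisum_ract (bisum_lact a x) b = bisum_lact a (bisum_ract x b).
Proof. by apply: dsumP => i; rewrite !dsumE lractA. Qed.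

HB.instance Definition _ := Lmodule_isBimodule.Build C A D
  bisum_lact_linearl bisum_lact_linearr bisum_ract_linearl bisum_ract_linearr
  bisum_lact1 bisum_ract1 bisum_lactM bisum_ractM bisum_lractA.
End DirectSumBimodule.

Notation bipow M n := (bisum (fun _ : 'I_n%N => M)).

(* U (x) V in coordinates on the vectors vbasis_i (x) vbasis_j; the universal *)
(* property is given by tens_liftE and tens_ext.                              *)
Definition tensor (C : fieldType) (U V : vectType C) : Type :=
  'M[C]_(\dim {:U}, \dim {:V}).

Section Tensor.
Variables (C : fieldType) (U V : vectType C).

HB.instance Definition _ :=
  Vector.copy (tensor U V) 'M[C]_(\dim {:U}, \dim {:V}).

Definition tens (u : U) (v : V) : tensor U V :=
  \matrix_(i, j) (coord (vbasis {:U}) i u * coord (vbasis {:V}) j v).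

Definition tens_lift (W : lmodType C) (b : U -> V -> W) (x : tensor U V) : W :=
  \sum_i \sum_j
    (x : 'M_(_, _)) i j *: b (vbasis {:U})`_i (vbasis {:V})`_j.

Definition bilin (W : lmodType C) (b : U -> V -> W) : Prop :=
  (forall v, linear (b^~ v)) /\ (forall u, linear (b u)).

Lemma tens_bilin : bilin tens.
Proof.
split=> [v c u1 u2|u c v1 v2]; apply/matrixP=> i j; rewrite !mxE linearP /=.
  by rewrite mulrDl mulrA.
by rewrite mulrDr mulrCA.
Qed.

Lemma tens_lift_linear (W : lmodType C) (b : U -> V -> W) :
  linear (tens_lift b).
Proof.
move=> c x y; rewrite /tens_lift scaler_sumr -big_split; apply: eq_bigr => i _.
rewrite scaler_sumr -big_split; apply: eq_bigr => j _.
by rewrite !mxE scalerDl scalerA.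
Qed.
HB.instance Definition _ (W : lmodType C) (b : U -> V -> W) :=
  GRing.isLinear.Build C (tensor U V) W _ (tens_lift b) (tens_lift_linear b).

Lemma tens_liftE (W : lmodType C) (b : U -> V -> W) u v :
  bilin b -> tens_lift b (tens u v) = b u v.
Proof.
case=> bl br.
pose blL v := GRing.isLinear.Build C U W _ (b^~ v) (bl v).
pose brL u := GRing.isLinear.Build C V W _ (b u) (br u).
pose fl v : {linear U -> W} := HB.pack (b^~ v) (blL v).
pose fr u : {linear V -> W} := HB.pack (b u) (brL u).
rewrite [in RHS](coord_vbasis (memvf u)).
rewrite [RHS](linear_sum (fl v)); apply: eq_bigr => i _.
rewrite [RHS](linearZ_LR (fl v)) /= [in RHS](coord_vbasis (memvf v)).
rewrite [X in _ *: X](linear_sum (fr _)) scaler_sumr; apply: eq_bigr => j _.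
by rewrite (linearZ_LR (fr _)) /= scalerA mxE.
Qed.

Lemma tens_span (x : tensor U V) : x = tens_lift tens x.
Proof.
apply/matrixP=> i j; rewrite /tens_lift summxE (bigD1 i) //=.
rewrite summxE (bigD1 j) //= !mxE !coord_free ?(basis_free (vbasisP _)) //.
rewrite !eqxx !mulr1 !big1 ?addr0 //.
  move=> i' ne; rewrite summxE big1 // => j' _.
  rewrite !mxE coord_free ?(basis_free (vbasisP _)) //.
  by rewrite (negPf ne) mul0r mulr0.
move=> j' ne; rewrite !mxE [X in _ * (_ * X)]coord_free
  ?(basis_free (vbasisP _)) //.
by rewrite (negPf ne) !mulr0.
Qed.

Lemma tens_ext (W : lmodType C) (f g : tensor U V -> W) :
    linear f -> linear g -> (forall u v, f (tens u v) = g (tens u v)) ->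
  f =1 g.
Proof.
move=> fL gL fg x.
pose f' : {linear tensor U V -> W} :=
  HB.pack f (GRing.isLinear.Build _ _ _ _ f fL).
pose g' : {linear tensor U V -> W} :=
  HB.pack g (GRing.isLinear.Build _ _ _ _ g gL).
rewrite [x]tens_span /tens_lift.
rewrite [LHS](raddf_sum f') [RHS](raddf_sum g'); apply: eq_bigr => i _.
rewrite [LHS](raddf_sum f') [RHS](raddf_sum g'); apply: eq_bigr => j _.
by rewrite [LHS](linearZ_LR f') [RHS](linearZ_LR g') /= fg.
Qed.
End Tensor.

Section DoubleDerivations.
Variables (C : fieldType) (A : falgType C).
Local Notation AA := (tensor A A).
Implicit Types (a b s t : A) (x : AA).

Definition outer_l a : AA -> AA := tens_lift (fun a' a'' => tens (a * a') a'').
Definition outer_r x b : AA := tens_lift (fun a' a'' => tens a' (a'' * b)) x.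
Definition inner_l a : AA -> AA := tens_lift (fun a' a'' => tens a' (a * a'')).
Definition inner_r x b : AA := tens_lift (fun a' a'' => tens (a' * b) a'') x.

Lemma bilin_l (f : {linear A -> A}) : bilin (fun a b => tens (f a) b : AA).
Proof.
have [tl tr] := tens_bilin A A.
by split=> [v c u1 u2|u c v1 v2]; rewrite ?linearP ?tl ?tr.
Qed.
Lemma bilin_r (f : {linear A -> A}) : bilin (fun a b => tens a (f b) : AA).
Proof.
have [tl tr] := tens_bilin A A.
by split=> [v c u1 u2|u c v1 v2]; rewrite ?linearP ?tl ?tr.
Qed.

Lemma outer_lE a a' a'' : outer_l a (tens a' a'') = tens (a * a') a''.
Proof. exact: tens_liftE (bilin_l (a \*o idfun)). Qed.
Lemma outer_rE b a' a'' : outer_r (tens a' a'') b = tens a' (a'' * b).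
Proof. exact: tens_liftE (bilin_r (b \o* idfun)). Qed.
Lemma inner_lE a a' a'' : inner_l a (tens a' a'') = tens a' (a * a'').
Proof. exact: tens_liftE (bilin_r (a \*o idfun)). Qed.
Lemma inner_rE b a' a'' : inner_r (tens a' a'') b = tens (a' * b) a''.
Proof. exact: tens_liftE (bilin_l (b \o* idfun)). Qed.

Lemma outer_l_linear a : linear (outer_l a).
Proof. exact: tens_lift_linear. Qed.
Lemma outer_r_linear b : linear (outer_r^~ b).
Proof. exact: tens_lift_linear. Qed.
Lemma inner_l_linear a : linear (inner_l a).
Proof. exact: tens_lift_linear. Qed.
Lemma inner_r_linear b : linear (inner_r^~ b).
Proof. exact: tens_lift_linear. Qed.

Fact tens_comp_linear (f g : AA -> AA) :
  linear f -> linear g -> linear (f \o g).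
Proof. by move=> fL gL c x y /=; rewrite gL fL. Qed.
Fact tens_id_linear : linear (id : AA -> AA). Proof. by []. Qed.
Fact tens_comb_linear c (f g : AA -> AA) :
  linear f -> linear g -> linear (fun x => c *: f x + g x).
Proof.
move=> fL gL d x y; rewrite fL gL !scalerDr !scalerA (mulrC c d).
by rewrite addrACA.
Qed.

Fact outer_l_linearl x : linear (outer_l^~ x).
Proof.
move=> c a b; move: x; apply: tens_ext => [||u v]; first exact: outer_l_linear.
  by apply: tens_comb_linear; apply: outer_l_linear.
rewrite !outer_lE mulrDl -scalerAl; exact: (tens_bilin A A).1.
Qed.
Fact outer_r_linearr x : linear (outer_r x).
Proof.
move=> c a b; move: x; apply: (tens_ext (outer_r_linear _)) => [|u v].
  by apply: tens_comb_linear; apply: outer_r_linear.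
rewrite !outer_rE mulrDr -scalerAr; exact: (tens_bilin A A).2.
Qed.
Fact outer_l1 x : outer_l 1 x = x.
Proof.
move: x; apply: (tens_ext (outer_l_linear _) tens_id_linear) => u v.
by rewrite outer_lE mul1r.
Qed.
Fact outer_r1 x : outer_r x 1 = x.
Proof.
move: x; apply: (tens_ext (outer_r_linear _) tens_id_linear) => u v.
by rewrite outer_rE mulr1.
Qed.
Fact outer_lM a b x : outer_l (a * b) x = outer_l a (outer_l b x).
Proof.
move: x; apply: (tens_ext (outer_l_linear _)) => [|u v].
  by apply: tens_comp_linear; apply: outer_l_linear.
by rewrite !outer_lE mulrA.
Qed.
Fact outer_rM a b x : outer_r x (a * b) = outer_r (outer_r x a) b.
Proof.
move: x; apply: (tens_ext (outer_r_linear _)) => [|u v].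
  exact: tens_comp_linear (outer_r_linear b) (outer_r_linear a).
by rewrite !outer_rE mulrA.
Qed.
Fact outer_lrA a b x : outer_r (outer_l a x) b = outer_l a (outer_r x b).
Proof.
move: x; apply: tens_ext => [||u v].
- exact: tens_comp_linear (outer_r_linear b) (outer_l_linear a).
- exact: tens_comp_linear (outer_l_linear a) (outer_r_linear b).
by rewrite !(outer_lE, outer_rE).
Qed.

HB.instance Definition _ := Lmodule_isBimodule.Build C A AA
  outer_l_linearl outer_l_linear outer_r_linear outer_r_linearr
  outer_l1 outer_r1 outer_lM outer_rM outer_lrA.

Fact inner_l_linearl x : linear (inner_l^~ x).
Proof.
move=> c a b; move: x; apply: (tens_ext (inner_l_linear _)) => [|u v].
  by apply: tens_comb_linear; apply: inner_l_linear.
rewrite !inner_lE mulrDl -scalerAl; exact: (tens_bilin A A).2.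
Qed.
Fact inner_r_linearr x : linear (inner_r x).
Proof.
move=> c a b; move: x; apply: (tens_ext (inner_r_linear _)) => [|u v].
  by apply: tens_comb_linear; apply: inner_r_linear.
rewrite !inner_rE mulrDr -scalerAr; exact: (tens_bilin A A).1.
Qed.
Fact inner_l1 x : inner_l 1 x = x.
Proof.
move: x; apply: (tens_ext (inner_l_linear _) tens_id_linear) => u v.
by rewrite inner_lE mul1r.
Qed.
Fact inner_r1 x : inner_r x 1 = x.
Proof.
move: x; apply: (tens_ext (inner_r_linear _) tens_id_linear) => u v.
by rewrite inner_rE mulr1.
Qed.
Fact inner_lM a b x : inner_l (a * b) x = inner_l a (inner_l b x).
Proof.
move: x; apply: (tens_ext (inner_l_linear _)) => [|u v].
  by apply: tens_comp_linear; apply: inner_l_linear.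
by rewrite !inner_lE mulrA.
Qed.
Fact inner_rM a b x : inner_r x (a * b) = inner_r (inner_r x a) b.
Proof.
move: x; apply: (tens_ext (inner_r_linear _)) => [|u v].
  exact: tens_comp_linear (inner_r_linear b) (inner_r_linear a).
by rewrite !inner_rE mulrA.
Qed.
Fact inner_lrA a b x : inner_r (inner_l a x) b = inner_l a (inner_r x b).
Proof.
move: x; apply: tens_ext => [||u v].
- exact: tens_comp_linear (inner_r_linear b) (inner_l_linear a).
- exact: tens_comp_linear (inner_l_linear a) (inner_r_linear b).
by rewrite !(inner_lE, inner_rE).
Qed.

Lemma inner_outer_ll a b x : inner_l a (outer_l b x) = outer_l b (inner_l a x).
Proof.
move: x; apply: tens_ext => [||u v].
- exact: tens_comp_linear (inner_l_linear a) (outer_l_linear b).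
- exact: tens_comp_linear (outer_l_linear b) (inner_l_linear a).
by rewrite !(inner_lE, outer_lE).
Qed.
Lemma inner_outer_lr a b x :
  inner_l a (outer_r x b) = outer_r (inner_l a x) b.
Proof.
move: x; apply: tens_ext => [||u v].
- exact: tens_comp_linear (inner_l_linear a) (outer_r_linear b).
- exact: tens_comp_linear (outer_r_linear b) (inner_l_linear a).
by rewrite !(inner_lE, outer_rE) mulrA.
Qed.
Lemma inner_outer_rl a b x :
  inner_r (outer_l b x) a = outer_l b (inner_r x a).
Proof.
move: x; apply: tens_ext => [||u v].
- exact: tens_comp_linear (inner_r_linear a) (outer_l_linear b).
- exact: tens_comp_linear (outer_l_linear b) (inner_r_linear a).
by rewrite !(inner_rE, outer_lE) mulrA.
Qed.
Lemma inner_outer_rr a b x :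
  inner_r (outer_r x b) a = outer_r (inner_r x a) b.
Proof.
move: x; apply: tens_ext => [||u v].
- exact: tens_comp_linear (inner_r_linear a) (outer_r_linear b).
- exact: tens_comp_linear (outer_r_linear b) (inner_r_linear a).
by rewrite !(inner_rE, outer_rE).
Qed.

Definition double_derivation : {pred 'Hom(A, AA)} := fun f =>
  `[< forall a b, f (a * b) = outer_r (f a) b + outer_l a (f b) >].

Lemma double_derivationP (f : 'Hom(A, AA)) :
  reflect (forall a b, f (a * b) = outer_r (f a) b + outer_l a (f b))
          (f \in double_derivation).
Proof. exact: asboolP. Qed.

Fact tens_linear0 (f : AA -> AA) : linear f -> f 0 = 0.
Proof.
by move=> fL; move: (fL (-1) 0 0); rewrite scaler0 addr0 scaleN1r addNr.
Qed.

Fact double_derivation_submod : submod_closed double_derivation.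
Proof.
split=> [|c f g /double_derivationP fD /double_derivationP gD].
  apply/double_derivationP => a b; rewrite !zero_lfunE.
  by rewrite (tens_linear0 (outer_r_linear b))
             (tens_linear0 (outer_l_linear a)) addr0.
apply/double_derivationP => a b; rewrite !add_lfunE !scale_lfunE fD gD.
by rewrite outer_r_linear outer_l_linear scalerDr addrACA.
Qed.
HB.instance Definition _ := GRing.isSubmodClosed.Build C 'Hom(A, AA)
  double_derivation double_derivation_submod.

(* Der(A, A (x) A), with the actions induced by the inner ones. *)
Record dder : Type := DDer {
  dder_val :> 'Hom(A, AA);
  _ : dder_val \in double_derivation
}.
HB.instance Definition _ := [isSub for dder_val].
HB.instance Definition _ := [Choice of dder by <:].
HB.instance Definition _ := [SubChoice_isSubZmodule of dder by <:].
HB.instance Definition _ := [SubZmodule_isSubLmodule of dder by <:].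

Lemma dderP (f g : dder) : (forall u, f u = g u) -> f = g.
Proof. by move=> fg; apply/val_inj/lfunP. Qed.

Definition dder_lact_fun s (f : 'Hom(A, AA)) (u : A) : AA := inner_l s (f u).
Definition dder_ract_fun (f : 'Hom(A, AA)) t (u : A) : AA := inner_r (f u) t.

Fact dder_lact_fun_linear s f : linear (dder_lact_fun s f).
Proof. by move=> c u v; rewrite /dder_lact_fun linearP inner_l_linear. Qed.
HB.instance Definition _ s f :=
  GRing.isLinear.Build C A AA _ _ (dder_lact_fun_linear s f).
Fact dder_ract_fun_linear f t : linear (dder_ract_fun f t).
Proof. by move=> c u v; rewrite /dder_ract_fun linearP inner_r_linear. Qed.
HB.instance Definition _ f t :=
  GRing.isLinear.Build C A AA _ _ (dder_ract_fun_linear f t).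

Fact dder_lact_subproof s (f : dder) :
  linfun (dder_lact_fun s f) \in double_derivation.
Proof.
apply/double_derivationP => a b; rewrite !lfunE /= /dder_lact_fun.
have /double_derivationP -> := valP f.
have -> x y : inner_l s (x + y) = inner_l s x + inner_l s y.
  by rewrite -[x]scale1r inner_l_linear !scale1r.
by rewrite inner_outer_ll inner_outer_lr.
Qed.
Fact dder_ract_subproof (f : dder) t :
  linfun (dder_ract_fun f t) \in double_derivation.
Proof.
apply/double_derivationP => a b; rewrite !lfunE /= /dder_ract_fun.
have /double_derivationP -> := valP f.
have -> x y : inner_r (x + y) t = inner_r x t + inner_r y t.
  by rewrite -[x]scale1r inner_r_linear !scale1r.
by rewrite inner_outer_rl inner_outer_rr.
Qed.

Definition dder_lact s (f : dder) : dder := DDer (dder_lact_subproof s f).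
Definition dder_ract (f : dder) t : dder := DDer (dder_ract_subproof f t).

Lemma dder_lactE s f u : dder_lact s f u = inner_l s (f u).
Proof. exact: lfunE. Qed.
Lemma dder_ractE f t u : dder_ract f t u = inner_r (f u) t.
Proof. exact: lfunE. Qed.
Lemma dderLE c (f g : dder) u : (c *: f + g) u = c *: f u + g u.
Proof. by rewrite add_lfunE scale_lfunE. Qed.

Fact dder_lact_linearl f : linear (dder_lact^~ f).
Proof.
by move=> c a b; apply: dderP => u; rewrite dderLE !dder_lactE inner_l_linearl.
Qed.
Fact dder_lact_linearr a : linear (dder_lact a).
Proof.
move=> c f g; apply: dderP => u.
by rewrite dderLE !dder_lactE dderLE inner_l_linear.
Qed.
Fact dder_ract_linearl a : linear (dder_ract^~ a).
Proof.
move=> c f g; apply: dderP => u.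
by rewrite dderLE !dder_ractE dderLE inner_r_linear.
Qed.
Fact dder_ract_linearr f : linear (dder_ract f).
Proof.
by move=> c a b; apply: dderP => u; rewrite dderLE !dder_ractE inner_r_linearr.
Qed.
Fact dder_lact1 f : dder_lact 1 f = f.
Proof. by apply: dderP => u; rewrite dder_lactE inner_l1. Qed.
Fact dder_ract1 f : dder_ract f 1 = f.
Proof. by apply: dderP => u; rewrite dder_ractE inner_r1. Qed.
Fact dder_lactM a b f : dder_lact (a * b) f = dder_lact a (dder_lact b f).
Proof. by apply: dderP => u; rewrite !dder_lactE inner_lM. Qed.
Fact dder_ractM a b f : dder_ract f (a * b) = dder_ract (dder_ract f a) b.
Proof. by apply: dderP => u; rewrite !dder_ractE inner_rM. Qed.
Fact dder_lractA a b f :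
  dder_ract (dder_lact a f) b = dder_lact a (dder_ract f b).
Proof. by apply: dderP => u; rewrite !(dder_lactE, dder_ractE) inner_lrA. Qed.

HB.instance Definition _ := Lmodule_isBimodule.Build C A dder
  dder_lact_linearl dder_lact_linearr dder_ract_linearl dder_ract_linearr
  dder_lact1 dder_ract1 dder_lactM dder_ractM dder_lractA.
End DoubleDerivations.

(* M_{d_1}(C) + ... + M_{d_k}(C) with componentwise operations. The           *)
(* positivity hypotheses make it a nonzero ring, as falgType requires.        *)
Definition matsum (C : fieldType) (k : nat) (d : 'I_k -> nat)
    (_ : (0 < k)%N) (_ : forall i, (0 < d i)%N) : Type :=
  @dsum C 'I_k (fun i => 'M[C]_(d i) : lmodType C).

Section MatrixSum.
Variables (C : fieldType) (k : nat) (d : 'I_k -> nat).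
Variables (k_gt0 : (0 < k)%N) (d_gt0 : forall i, (0 < d i)%N).
Local Notation S := (@matsum C k d k_gt0 d_gt0).
Implicit Types x y z : S.

HB.instance Definition _ := GRing.Lmodule.copy S
  (@dsum C 'I_k (fun i => 'M[C]_(d i) : lmodType C)).
HB.instance Definition _ := Lmodule_hasFinDim.Build C S
  (dsum_vect_iso (fun i => 'M[C]_(d i) : vectType C)).

Definition blk x (i : 'I_k) : 'M[C]_(d i) := dsum_at x i.
Definition mkS (f : forall i, 'M[C]_(d i)) : S :=
  mkds (fun i => f i : ('M[C]_(d i) : lmodType C)).
Lemma blkE f i : blk (mkS f) i = f i. Proof. exact: mkdsE. Qed.
Lemma blkP x y : (forall i, blk x i = blk y i) -> x = y.
Proof. exact: dsumP. Qed.
Lemma blkD x y i : blk (x + y) i = blk x i + blk y i.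
Proof. exact: mkdsE. Qed.
Lemma blkZ c x i : blk (c *: x) i = c *: blk x i.
Proof. exact: mkdsE. Qed.

Definition matsum_one : S := mkS (fun i => 1%:M).
Definition matsum_mul x y : S := mkS (fun i => blk x i *m blk y i).

Fact matsum_mulA : associative matsum_mul.
Proof. by move=> x y z; apply: blkP => i; rewrite !blkE mulmxA. Qed.
Fact matsum_mul1l : left_id matsum_one matsum_mul.
Proof. by move=> x; apply: blkP => i; rewrite !blkE mul1mx. Qed.
Fact matsum_mul1r : right_id matsum_one matsum_mul.
Proof. by move=> x; apply: blkP => i; rewrite !blkE mulmx1. Qed.
Fact matsum_mulDl : left_distributive matsum_mul +%R.
Proof. by move=> x y z; apply: blkP => i; rewrite !(blkE, blkD) mulmxDl. Qed.
Fact matsum_mulDr : right_distributive matsum_mul +%R.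
Proof. by move=> x y z; apply: blkP => i; rewrite !(blkE, blkD) mulmxDr. Qed.
Fact matsum_one_neq0 : matsum_one != 0.
Proof.
apply/eqP => /(congr1 (fun x => blk x (Ordinal k_gt0))).
rewrite blkE [RHS]mkdsE => /matrixP
  /(_ (Ordinal (d_gt0 _)) (Ordinal (d_gt0 _))).
by rewrite !mxE eqxx => /eqP; rewrite oner_eq0.
Qed.
HB.instance Definition _ := GRing.Zmodule_isNzRing.Build S
  matsum_mulA matsum_mul1l matsum_mul1r matsum_mulDl matsum_mulDr
  matsum_one_neq0.

Fact matsum_scaleAl c x y : c *: (x * y) = c *: x * y.
Proof. by apply: blkP => i; rewrite !(blkE, blkZ) scalemxAl. Qed.
Fact matsum_scaleAr c x y : c *: (x * y) = x * (c *: y).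
Proof. by apply: blkP => i; rewrite !(blkE, blkZ) scalemxAr. Qed.
HB.instance Definition _ := GRing.Lmodule_isLalgebra.Build C S matsum_scaleAl.
HB.instance Definition _ := GRing.Lalgebra_isAlgebra.Build C S matsum_scaleAr.
HB.instance Definition _ := Algebra_isFalgebra.Build C S.

(* M_{d_i x d_j}(C) as a bimodule over matsum: s acts on the left through its *)
(* i-th component and t on the right through its j-th one. The two ignored    *)
(* arguments determine the instance of matsum that acts.                      *)
Definition mxblk (_ : (0 < k)%N) (_ : forall i, (0 < d i)%N) (i j : 'I_k) :
  Type := 'M[C]_(d i, d j).
Local Notation B i j := (mxblk k_gt0 d_gt0 i j).
HB.instance Definition _ i j := GRing.Lmodule.copy (B i j) 'M[C]_(d i, d j).

Section Block.
Variables (i j : 'I_k).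
Implicit Types (s t : S) (m : B i j).

Definition mxblk_lact s m : B i j := blk s i *m (m : 'M_(_, _)).
Definition mxblk_ract m t : B i j := (m : 'M_(_, _)) *m blk t j.

Fact mxblk_lact_linearl m : linear (mxblk_lact^~ m).
Proof.
by move=> c s t; rewrite /mxblk_lact blkD blkZ mulmxDl -scalemxAl.
Qed.
Fact mxblk_lact_linearr s : linear (mxblk_lact s).
Proof. by move=> c m n; rewrite /mxblk_lact mulmxDr -scalemxAr. Qed.
Fact mxblk_ract_linearl t : linear (mxblk_ract^~ t).
Proof. by move=> c m n; rewrite /mxblk_ract mulmxDl -scalemxAl. Qed.
Fact mxblk_ract_linearr m : linear (mxblk_ract m).
Proof.
by move=> c s t; rewrite /mxblk_ract blkD blkZ mulmxDr -scalemxAr.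
Qed.
Fact mxblk_lact1 m : mxblk_lact 1 m = m.
Proof. by rewrite /mxblk_lact blkE mul1mx. Qed.
Fact mxblk_ract1 m : mxblk_ract m 1 = m.
Proof. by rewrite /mxblk_ract blkE mulmx1. Qed.
Fact mxblk_lactM s t m : mxblk_lact (s * t) m = mxblk_lact s (mxblk_lact t m).
Proof. by rewrite /mxblk_lact blkE mulmxA. Qed.
Fact mxblk_ractM s t m : mxblk_ract m (s * t) = mxblk_ract (mxblk_ract m s) t.
Proof. by rewrite /mxblk_ract blkE mulmxA. Qed.
Fact mxblk_lractA s t m :
  mxblk_ract (mxblk_lact s m) t = mxblk_lact s (mxblk_ract m t).
Proof. by rewrite /mxblk_ract /mxblk_lact mulmxA. Qed.

HB.instance Definition _ := Lmodule_isBimodule.Build C S (B i j)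
  mxblk_lact_linearl mxblk_lact_linearr mxblk_ract_linearl mxblk_ract_linearr
  mxblk_lact1 mxblk_ract1 mxblk_lactM mxblk_ractM mxblk_lractA.
End Block.
End MatrixSum.

(* Main.v *)
From HB Require Import structures.
Require Import Defs.
From mathcomp Require Import all_boot all_algebra all_field.
Set Implicit Arguments.
Unset Strict Implicit.
Unset Printing Implicit Defensive.
Import GRing.Theory.
Local Open Scope ring_scope.

(** Write S for the sum of the M_{d_i}, and E^p_{ab} for its matrix units. For
    blocks p and q, an index e of block p and an index a of block q, the slice
    of u (x) v is the column e of v_p times the row a of u_q, a d_p x d_q
    matrix. As v is a right factor and u a left one, the inner actions of s and
    t multiply every slice by s_p on the left and t_q on the right, so that the
    slices identify S (x) S, with its inner structure, with the sum over (p,q)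
    of d_p d_q copies of M_{d_p x d_q} ([slice_inner_l], [slice_inner_r],
    [sliceP], [slice_unslice]). The outer actions, on the other hand, only form
    linear combinations of slices, along e and along a respectively.

    S is separable, hence every double derivation is u |-> x u - u x for some x
    in S (x) S. In terms of slices this is a commutator, so that for p <> q the
    slices of x are determined by the derivation, while for p = q only a
    multiple of the identity, with a coefficient in M_{d_p}, is lost: exactly one of the d_p^2 copies of
    M_{d_p} disappears. Requiring the slice of x at the first pair of indices
    (0,0) of every diagonal block to vanish makes x unique. The slices of this
    normalised x are then read off on matrix units: the slice of x at (e,a) is
    the slice of D(E^p_{e0}) at (0,a). This is the definition of [coordinate];
    it is visibly a bimodule map in D.

    Both inverse identities are short computations. The product rule applied to
    u E^p_{e0} = sum_e' u_{e'e} E^p_{e'0} expresses each slice of D(u) as the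
    commutator of u with the coordinates of D ([slice_dder]), so D is recovered
    from its coordinates. Conversely the coordinates of the commutator with a
    normalised x are the slices of x ([coordinate_inner_dder]). *)

(** * Numbering a finite type *)

Definition numbering (T : finType) n (cT : #|{: T}| = n) (j : 'I_n) : T :=
  enum_val (cast_ord (esym cT) j).

Definition number (T : finType) n (cT : #|{: T}| = n) (t : T) : 'I_n :=
  cast_ord cT (enum_rank t).

Lemma numberingK (T : finType) n (cT : #|{: T}| = n) :
  cancel (numbering cT) (number cT).
Proof. by move=> j; rewrite /number enum_valK cast_ordKV. Qed.

Lemma numberK (T : finType) n (cT : #|{: T}| = n) :
  cancel (number cT) (numbering cT).
Proof. by move=> t; rewrite /numbering cast_ordK enum_rankK. Qed.

(** * Matrix units *)

Section SemisimpleAlgebra.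
Variables (C : fieldType) (k : nat) (d : 'I_k -> nat).
Variables (k_gt0 : (0 < k)%N) (d_gt0 : forall i, (0 < d i)%N).
Local Notation S := (matsum C k_gt0 d_gt0).
Local Notation SS := (tensor S S).
Implicit Types (s t u v : S) (x y : SS) (D : dder S) (p q i : 'I_k).

Local Notation position := {i : 'I_k & ('I_(d i) * 'I_(d i))%type}.

Definition pos i (a b : 'I_(d i)) : position :=
  Tagged (fun i => 'I_(d i) * 'I_(d i))%type (a, b).

Definition munit (r : position) : S :=
  mkS k_gt0 d_gt0 (fun i => \matrix_(a, b) (pos a b == r)%:R).

Definition entry (r : position) u : C :=
  blk u (tag r) (tagged r).1 (tagged r).2.

Lemma munitE r i (a b : 'I_(d i)) : blk (munit r) i a b = (pos a b == r)%:R.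
Proof. by rewrite blkE mxE. Qed.

Lemma blk_sum (I : finType) (F : I -> S) i :
  blk (\sum_j F j) i = \sum_j blk (F j) i.
Proof.
apply: (big_morph (fun u => blk u i)) => [u v|]; first exact: blkD.
exact: mkdsE.
Qed.

Lemma sum_munit u : u = \sum_r entry r u *: munit r.
Proof.
apply: blkP => i; apply/matrixP => a b; rewrite blk_sum summxE.
have termE r : blk (entry r u *: munit r) i a b = entry r u * (pos a b == r)%:R.
  by rewrite blkZ mxE munitE.
under eq_bigr do rewrite termE.
rewrite (bigD1 (pos a b)) //= eqxx mulr1 big1 ?addr0 // => r ne.
by rewrite eq_sym (negPf ne) mulr0.
Qed.

Lemma pos_eq i (a b a' b' : 'I_(d i)) :
  (pos a b == pos a' b') = (a == a') && (b == b').
Proof. by rewrite eq_Tagged. Qed.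

(** Needed besides [pos_eq] because indices of different blocks have different
    types, so that their components cannot be compared. *)
Lemma pos_neq p q (a b : 'I_(d p)) (a' b' : 'I_(d q)) :
  p != q -> (pos a b == pos a' b') = false.
Proof.
by move=> ne; apply: contraNF ne => /eqP /(congr1 tag) /= ->.
Qed.

(** A column of matrix units spans a left ideal of S, on which u acts through
    the entries of its block. Applied to this formula, the product rule shows
    that the values at one column of each block determine a derivation. *)
Lemma mul_munit u p (e b : 'I_(d p)) :
  u * munit (pos e b) = \sum_e' blk u p e' e *: munit (pos e' b).
Proof.
apply: blkP => i; apply/matrixP => r c; rewrite blk_sum summxE blkE mxE.
under [RHS]eq_bigr do rewrite blkZ mxE munitE.
under [LHS]eq_bigr do rewrite munitE.
have [eq|ne] := altP (i =P p); last first.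
  by rewrite !big1 // => e' _; rewrite pos_neq ?mulr0.
subst i; rewrite (bigD1 e) //= [RHS](bigD1 r) //= !pos_eq !eqxx /=.
by rewrite !big1 ?addr0 // => e' ne; rewrite pos_eq 1?[r == _]eq_sym (negPf ne) ?andbF mulr0.
Qed.

(** * Slices of a tensor *)

Definition slice p q (e : 'I_(d p)) (a : 'I_(d q)) :
    SS -> 'M[C]_(d p, d q) :=
  tens_lift (fun u v => col e (blk v p) *m row a (blk u q)).

Lemma slice_bilin p q (e : 'I_(d p)) (a : 'I_(d q)) :
  bilin (fun u v : S => col e (blk v p) *m row a (blk u q) : 'M[C]_(d p, d q)).
Proof.
split=> [v c u1 u2|u c v1 v2]; rewrite blkD blkZ linearP /=.
  by rewrite mulmxDr -scalemxAr.
by rewrite mulmxDl -scalemxAl.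
Qed.

Lemma slice_tens p q (e : 'I_(d p)) (a : 'I_(d q)) u v :
  slice e a (tens u v) = col e (blk v p) *m row a (blk u q).
Proof. exact: tens_liftE (slice_bilin e a). Qed.

Lemma slice_linear p q (e : 'I_(d p)) (a : 'I_(d q)) : linear (slice e a).
Proof. exact: tens_lift_linear. Qed.
HB.instance Definition _ p q (e : 'I_(d p)) (a : 'I_(d q)) :=
  GRing.isLinear.Build C SS 'M[C]_(d p, d q) _ (slice e a) (slice_linear e a).

Lemma slice_tens_entry p q (e : 'I_(d p)) (a : 'I_(d q)) u v c b :
  slice e a (tens u v) c b = blk v p c e * blk u q a b.
Proof. by rewrite slice_tens mxE big_ord1 !mxE. Qed.

Lemma slice_inner_l p q (e : 'I_(d p)) (a : 'I_(d q)) s x :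
  slice e a (inner_l s x) = blk s p *m slice e a x.
Proof.
move: x; apply: tens_ext => [c x y|c x y|u v].
- by rewrite inner_l_linear linearP.
- by rewrite linearP mulmxDr scalemxAr.
by rewrite inner_lE !slice_tens blkE !colE !mulmxA.
Qed.

Lemma slice_inner_r p q (e : 'I_(d p)) (a : 'I_(d q)) s x :
  slice e a (inner_r x s) = slice e a x *m blk s q.
Proof.
move: x; apply: tens_ext => [c x y|c x y|u v].
- by rewrite inner_r_linear linearP.
- by rewrite linearP mulmxDl scalemxAl.
by rewrite inner_rE !slice_tens blkE -mulmxA row_mul.
Qed.

(** The outer left action meets the factor u, of which a slice only sees the
    row a: it mixes the slices that differ in a. *)
Lemma slice_outer_l p q (e : 'I_(d p)) (a : 'I_(d q)) s x :
  slice e a (outer_l s x) = \sum_a' blk s q a a' *: slice e a' x.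
Proof.
move: x; apply: tens_ext => [c x y|c x y|u v].
- by rewrite outer_l_linear linearP.
- rewrite scaler_sumr -big_split; apply: eq_bigr => a' _ /=.
  by rewrite linearP scalerDr !scalerA mulrC.
rewrite outer_lE slice_tens blkE row_mul mulmx_sum_row mulmx_sumr.
by apply: eq_bigr => a' _; rewrite slice_tens mxE scalemxAr.
Qed.

(** The outer right action meets the factor v, of which a slice only sees the
    column e: it mixes the slices that differ in e. *)
Lemma slice_outer_r p q (e : 'I_(d p)) (a : 'I_(d q)) s x :
  slice e a (outer_r x s) = \sum_e' blk s p e' e *: slice e' a x.
Proof.
move: x; apply: tens_ext => [c x y|c x y|u v].
- by rewrite outer_r_linear linearP.
- rewrite scaler_sumr -big_split; apply: eq_bigr => a' _ /=.
  by rewrite linearP scalerDr !scalerA mulrC.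
apply/matrixP => c b; rewrite outer_rE slice_tens_entry summxE blkE mxE mulr_suml.
by apply: eq_bigr => e' _; rewrite mxE slice_tens_entry mulrA [_ * blk s _ _ _]mulrC.
Qed.

Definition slice_family : Type :=
  forall p q, 'I_(d p) -> 'I_(d q) -> 'M[C]_(d p, d q).

(** The tensor E^q_{ab} (x) E^p_{ce} has a single nonzero slice, at (e,a), and
    that slice is the matrix unit with entry 1 at (c,b); whence the order of
    the indices. *)
Definition unslice (X : slice_family) : SS :=
  \sum_r \sum_r' X (tag r') (tag r) (tagged r').2 (tagged r).1
                   (tagged r').1 (tagged r).2 *: tens (munit r) (munit r').

Lemma unslice_slices (x : SS) :
  x = unslice (fun p q e a => slice e a x).
Proof.
move: x; apply: tens_ext => // [c x y|u v].
  rewrite /unslice scaler_sumr -big_split; apply: eq_bigr => r _ /=.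
  rewrite scaler_sumr -big_split; apply: eq_bigr => r' _ /=.
  by rewrite linearP !mxE scalerDl scalerA.
have [tl tr] := tens_bilin S S.
pose fl w : {linear S -> SS} :=
  HB.pack (fun z : S => tens z w : SS) (GRing.isLinear.Build C S SS _ _ (tl w)).
pose fr w : {linear S -> SS} :=
  HB.pack (fun z : S => tens w z : SS) (GRing.isLinear.Build C S SS _ _ (tr w)).
rewrite {1}[u]sum_munit [LHS](linear_sum (fl v)); apply: eq_bigr => r _.
rewrite [LHS](linearZ_LR (fl v)) /= {1}[v]sum_munit.
rewrite [X in _ *: X](linear_sum (fr (munit r))) scaler_sumr.
apply: eq_bigr => r' _; rewrite (linearZ_LR (fr (munit r))) /= scalerA.
by rewrite slice_tens_entry mulrC.
Qed.

Lemma slice_unslice (X : slice_family) p q (e : 'I_(d p)) (a : 'I_(d q)) :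
  slice e a (unslice X) = X p q e a.
Proof.
apply/matrixP => c b.
have termE (z : C) r r' :
    slice e a (z *: tens (munit r) (munit r')) c b
      = z * ((pos c e == r')%:R * (pos a b == r)%:R).
  by rewrite linearZ mxE slice_tens_entry !munitE.
have -> : slice e a (unslice X) c b = \sum_r \sum_r'
    X (tag r') (tag r) (tagged r').2 (tagged r).1 (tagged r').1 (tagged r).2
      * ((pos c e == r')%:R * (pos a b == r)%:R).
  rewrite /unslice linear_sum summxE; apply: eq_bigr => r _.
  rewrite linear_sum summxE; apply: eq_bigr => r' _; exact: termE.
rewrite (bigD1 (pos a b)) //= (bigD1 (pos c e)) //= !eqxx !mulr1.
rewrite !big1 ?addr0 // => [r ne|r' ne].
  by rewrite big1 // => r' _; rewrite [_ == r]eq_sym (negPf ne) !mulr0.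
by rewrite [_ == r']eq_sym (negPf ne) mul0r mulr0.
Qed.

Lemma sliceP x y :
  (forall p q (e : 'I_(d p)) (a : 'I_(d q)), slice e a x = slice e a y) ->
  x = y.
Proof.
move=> xy; rewrite [x]unslice_slices [y]unslice_slices /unslice.
by do 2!apply: eq_bigr => ? _; rewrite xy.
Qed.

(** * Double derivations as commutators *)

Definition commutator x u : SS := outer_r x u - outer_l u x.

Lemma commutator_linear x : linear (commutator x).
Proof.
move=> c u v; rewrite /commutator outer_r_linearr outer_l_linearl.
by rewrite scalerBr opprD addrACA.
Qed.
HB.instance Definition _ x :=
  GRing.isLinear.Build C S SS _ (commutator x) (commutator_linear x).

Lemma commutator_dder x : linfun (commutator x) \in @double_derivation C S.
Proof.
apply/double_derivationP => s t; rewrite !lfunE /= /commutator.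
have outer_rB y z : outer_r (y - z) t = outer_r y t - outer_r z t.
  by rewrite addrC -scaleN1r outer_r_linear scaleN1r addrC.
have outer_lB y z : outer_l s (y - z) = outer_l s y - outer_l s z.
  by rewrite addrC -scaleN1r outer_l_linear scaleN1r addrC.
by rewrite outer_rB outer_lB outer_rM outer_lM outer_lrA addrA subrK.
Qed.

Definition inner_dder x : dder S := DDer (commutator_dder x).

Lemma inner_dderE x u : inner_dder x u = outer_r x u - outer_l u x.
Proof. exact: lfunE. Qed.

Definition first i : 'I_(d i) := Ordinal (d_gt0 i).

(** For the commutator with x, this is the slice (0,a) of
    x E^p_{e0} - E^p_{e0} x. Its first term is the slice (e,a) of x, and its
    second one is zero unless p = q and e = a, where it is the slice (0,0). *)
Definition coordinate p q (e : 'I_(d p)) (a : 'I_(d q)) D : 'M[C]_(d p, d q) :=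
  slice (first p) a (D (munit (pos e (first p)))).

(** Multiplication by E^p_{e0} carries the slice (e,a) to the place (0,a), so
    that the one slice used in [coordinate] sees all slices of x. *)
Lemma slice_outer_r_munit p q (e : 'I_(d p)) (a : 'I_(d q)) x :
  slice (first p) a (outer_r x (munit (pos e (first p)))) = slice e a x.
Proof.
rewrite slice_outer_r (bigD1 e) //= munitE eqxx scale1r big1 ?addr0 //.
by move=> e' ne; rewrite munitE pos_eq (negPf ne) scale0r.
Qed.

(** The idempotent m = E^p_{00} satisfies D(m) = D(m) m + m D(m), and both
    summands have the same slice at (0,0) as D(m); so this slice is twice
    itself, that is zero. This is the copy of M_{d_p}
    that is missing among the coordinates. *)
Lemma coordinate_first p D : coordinate (first p) (first p) D = 0.
Proof.
rewrite /coordinate; set m := munit _.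
have mm : m * m = m.
  rewrite mul_munit (bigD1 (first p)) //= munitE eqxx scale1r big1 ?addr0 //.
  by move=> e' ne; rewrite munitE pos_eq (negPf ne) scale0r.
have /double_derivationP /(_ m m) := valP D.
rewrite mm => /(congr1 (slice (first p) (first p))).
rewrite linearD /= slice_outer_r_munit.
rewrite slice_outer_l (bigD1 (first p)) //= munitE eqxx scale1r big1 ?addr0.
  by move=> /eqP; rewrite -subr_eq subrr eq_sym => /eqP.
by move=> e' ne; rewrite munitE pos_eq (negPf ne) andbF scale0r.
Qed.

(** Every double derivation is inner: evaluate D(u E^p_{e0}) at the slice (0,a),
    once by [mul_munit] and once by the product rule. *)
Lemma slice_dder p q (e : 'I_(d p)) (a : 'I_(d q)) D u :
  slice e a (D u) = \sum_e' blk u p e' e *: coordinate e' a D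
                    - \sum_a' blk u q a a' *: coordinate e a' D.
Proof.
have /double_derivationP /(_ u (munit (pos e (first p)))) := valP D.
rewrite mul_munit => /(congr1 (slice (first p) a)).
rewrite linearD /= slice_outer_r_munit slice_outer_l => /esym h.
(* [h] is the product rule: slice of D(u) plus the outer left term. *)
apply: (canRL (addrK _)); rewrite [LHS]h !linear_sum.
by apply: eq_bigr => e' _; rewrite !linearZ.
Qed.

(** The normalisation removes the only contribution of u x, which comes from
    the slice (0,0) of a diagonal block. *)
Lemma coordinate_inner_dder x p q (e : 'I_(d p)) (a : 'I_(d q)) :
    (forall i, slice (first i) (first i) x = 0) ->
  coordinate e a (inner_dder x) = slice e a x.
Proof.
move=> x0; rewrite /coordinate inner_dderE linearB /= slice_outer_r_munit.
rewrite slice_outer_l big1 ?subr0 // => a' _; rewrite munitE.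
have [eq|ne] := altP (q =P p); last by rewrite pos_neq ?scale0r.
subst q; rewrite pos_eq; have [-> | _] := altP (a' =P first p).
  by rewrite x0 scaler0.
by rewrite andbF scale0r.
Qed.

Lemma inner_dder_slice D x :
    (forall p q (e : 'I_(d p)) (a : 'I_(d q)),
       slice e a x = coordinate e a D) ->
  inner_dder x = D.
Proof.
move=> xD; apply: dderP => u; apply: sliceP => p q e a.
rewrite [RHS]slice_dder inner_dderE linearB /= slice_outer_l slice_outer_r.
by congr (_ - _); apply: eq_bigr => ? _; rewrite xD.
Qed.

(** * Coordinates form a bimodule map *)

Lemma coordinate_linear p q (e : 'I_(d p)) (a : 'I_(d q)) :
  linear (coordinate e a).
Proof. by move=> c f g; rewrite /coordinate dderLE linearP. Qed.

Lemma coordinate_lact p q (e : 'I_(d p)) (a : 'I_(d q)) s D :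
  coordinate e a (dder_lact s D) = blk s p *m coordinate e a D.
Proof. by rewrite /coordinate dder_lactE slice_inner_l. Qed.

Lemma coordinate_ract p q (e : 'I_(d p)) (a : 'I_(d q)) D s :
  coordinate e a (dder_ract D s) = coordinate e a D *m blk s q.
Proof. by rewrite /coordinate dder_ractE slice_inner_r. Qed.

(** * The isomorphism *)

(** Opaque and stated on its own so that a case analysis on p = q can abstract
    the test without touching this proof. *)
Lemma neq_index p q : p <> q -> p != q.
Proof. by move/eqP. Qed.

(** On the diagonal the family Y p has to be transported along p = q, since the
    index types depend on q. *)
Definition glue
    (Y : forall i, 'I_(d i) -> 'I_(d i) -> 'M[C]_(d i, d i))
    (Z : forall ij : {ij : 'I_k * 'I_k | ij.1 != ij.2},
       'I_(d (sval ij).1) -> 'I_(d (sval ij).2) ->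
       'M[C]_(d (sval ij).1, d (sval ij).2)) : slice_family :=
  fun p q => match p =P q with
  | ReflectT pq =>
      eq_rect p (fun i => 'I_(d p) -> 'I_(d i) -> 'M[C]_(d p, d i)) (Y p) q pq
  | ReflectF pq => Z (exist _ (p, q) (neq_index pq))
  end.

Lemma glue_diagonal Y Z i : @glue Y Z i i = Y i.
Proof. by rewrite /glue; case: eqP => // ii; rewrite (eq_irrelevance ii erefl). Qed.

Lemma glue_off_diagonal Y Z (ij : {ij : 'I_k * 'I_k | ij.1 != ij.2}) :
  @glue Y Z (sval ij).1 (sval ij).2 = Z ij.
Proof.
case: ij => [[p q] /= pq]; rewrite /glue; case: eqP => [eq | ne].
  by case/eqP: (pq).
by rewrite (bool_irrelevance (neq_index ne) pq).
Qed.

Definition off_first i : Type :=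
  {ea : 'I_(d i) * 'I_(d i) | ea != (first i, first i)}.
HB.instance Definition _ i := Finite.on (off_first i).

Lemma card_off_first i : #|{: off_first i}| = (d i ^ 2 - 1)%N.
Proof.
by rewrite card_sig cardC1 card_prod card_ord -subn1 mulnn.
Qed.

Lemma card_entries p q : #|{: 'I_(d p) * 'I_(d q)}| = (d p * d q)%N.
Proof. by rewrite card_prod !card_ord. Qed.

Local Notation target :=
  (bisum (fun i : 'I_k => bipow (mxblk C k_gt0 d_gt0 i i) (d i ^ 2 - 1)) *
   bisum (fun ij : {ij : 'I_k * 'I_k | ij.1 != ij.2} =>
     bipow (mxblk C k_gt0 d_gt0 (sval ij).1 (sval ij).2)
           (d (sval ij).1 * d (sval ij).2)))%type.

Definition coordinates D : target :=
  (mkds (fun i => mkds (fun n =>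
     let ea := sval (numbering (card_off_first i) n) in
     coordinate ea.1 ea.2 D)),
   mkds (fun ij => mkds (fun n =>
     let ea := numbering (card_entries (sval ij).1 (sval ij).2) n in
     coordinate ea.1 ea.2 D))).

(** The default value 0 is reached only at the pair (0,0) of a diagonal block:
    it is the normalisation that makes the tensor unique. *)
Definition slices_of (y : target) : slice_family :=
  glue (fun i e a =>
          if insub (e, a) is Some ea
          then dsum_at (dsum_at y.1 i) (number (card_off_first i) ea) else 0)
       (fun ij e a =>
          dsum_at (dsum_at y.2 ij)
            (number (card_entries (sval ij).1 (sval ij).2) (e, a))).

Definition dder_of (y : target) : dder S := inner_dder (unslice (slices_of y)).

Lemma coordinates_linear : linear coordinates.
Proof.
move=> c f g; congr pair; apply: dsumP => i; apply: dsumP => n;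
  rewrite !dsumE; exact: coordinate_linear.
Qed.

Lemma coordinates_lact s D : coordinates (lact s D) = lact s (coordinates D).
Proof.
congr pair; apply: dsumP => i; apply: dsumP => n;
  rewrite !dsumE; exact: coordinate_lact.
Qed.

Lemma coordinates_ract D s : coordinates (ract D s) = ract (coordinates D) s.
Proof.
congr pair; apply: dsumP => i; apply: dsumP => n;
  rewrite !dsumE; exact: coordinate_ract.
Qed.

Lemma coordinatesK : cancel coordinates dder_of.
Proof.
move=> D; apply: inner_dder_slice => p q e a; rewrite slice_unslice.
have [pq | pq] := altP (p =P q); last first.
  rewrite /slices_of (glue_off_diagonal _ _ (exist _ (p, q) pq)) !mkdsE.
  by rewrite numberK.
subst q; rewrite /slices_of glue_diagonal.
case: insubP => [ea _ eaE | /negPn /eqP [-> ->]].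
  by rewrite !mkdsE numberK /= eaE.
by rewrite coordinate_first.
Qed.

Lemma dder_ofK : cancel dder_of coordinates.
Proof.
move=> y; have y0 i : slice (first i) (first i) (unslice (slices_of y)) = 0.
  by rewrite slice_unslice /slices_of glue_diagonal insubF ?eqxx.
rewrite [RHS]surjective_pairing; congr pair; apply: dsumP => i;
  apply: dsumP => n; rewrite !mkdsE /dder_of coordinate_inner_dder // slice_unslice.
  rewrite /slices_of glue_diagonal -surjective_pairing valK.
  by rewrite numberingK.
by rewrite /slices_of glue_off_diagonal -surjective_pairing numberingK.
Qed.

Theorem dder_decomposition : bimod_isomorphic (dder S) target.
Proof.
pose f : {linear dder S -> target} :=
  HB.pack coordinates (GRing.isLinear.Build C _ _ _ _ coordinates_linear).
exists f; split; [| exact: coordinates_lact | exact: coordinates_ract].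
by exists dder_of; [exact: coordinatesK | exact: dder_ofK].
Qed.

End SemisimpleAlgebra.

Theorem theorem1 (C : closedFieldType) (charC0 : [pchar C] =i pred0)
    (k : nat) (d : 'I_k -> nat)
    (k_gt0 : (0 < k)%N) (d_gt0 : forall i : 'I_k, (0 < d i)%N) :
  bimod_isomorphic
    (dder (matsum C k_gt0 d_gt0))
    (bisum (fun i : 'I_k =>
       bipow (mxblk C k_gt0 d_gt0 i i) (d i ^ 2 - 1)) *
     bisum (fun ij : {ij : 'I_k * 'I_k | ij.1 != ij.2} =>
       bipow (mxblk C k_gt0 d_gt0 (sval ij).1 (sval ij).2)
             (d (sval ij).1 * d (sval ij).2)))%type.
Proof. exact: dder_decomposition. Qed.
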